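(* Let $n\geq2$, let $\lambda_1,\ldots,\lambda_{n-1}\in\mathbb{R}\setminus\{0\}$ and $\alpha\in\mathbb{R}\setminus\{0\}$ be constants, $I$ an open interval in $\mathbb{R}$, and let $\theta:I\to\mathbb{R}$, $w_1,\ldots,w_{n-1}:I\to\mathbb{C}\setminus\{0\}$ and $\beta:I\to\mathbb{C}$ be smooth functions satisfying on $I$ $$\frac{dw_j}{ds}=\lambda_je^{i\theta(s)}\,\overline{w_1\cdots w_{j-1}w_{j+1}\cdots w_{n-1}},\ \ j=1,\ldots,n-1,\qquad \frac{d\theta}{ds}=\alpha\,\mathrm{Im}\bigl(e^{-i\theta}w_1\cdots w_{n-1}\bigr),\qquad \frac{d\beta}{ds}=e^{i\theta(s)}\,\overline{w_1\cdots w_{n-1}}.$$ Let $$L=\Bigl\{\bigl(x_1w_1(s),\ldots,x_{n-1}w_{n-1}(s),\,-\tfrac12\sum_{j=1}^{n-1}\lambda_jx_j^2+\beta(s)\bigr):x_1,\ldots,x_{n-1}\in\mathbb{R},\ s\in I\Bigr\}\subset\mathbb{C}^n$$ be the associated Lagrangian translating soliton. Then $L$ may be rewritten as $$L=\Bigl\{\bigl(x_1\sqrt{\alpha_1+\lambda_1u(s)}\,e^{i\phi_1(s)},\ldots,x_{n-1}\sqrt{\alpha_{n-1}+\lambda_{n-1}u(s)}\,e^{i\phi_{n-1}(s)},\ \tfrac12u(s)-\tfrac12\sum_{j=1}^{n-1}\lambda_jx_j^2-\tfrac{i}{\alpha}\theta(s)+K\bigr):x_1,\ldots,x_{n-1}\in\mathbb{R},\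 s\in I\Bigr\}$$ for some $K\in\mathbb{C}$, where $u,\alpha_1,\ldots,\alpha_{n-1},\phi_1,\ldots,\phi_{n-1}$ are as defined in the context and satisfy, with $\phi=\sum_{j=1}^{n-1}\phi_j$ and $Q(u)=\prod_{j=1}^{n-1}(\alpha_j+\lambda_ju)$, $$\frac{du}{ds}=2Q(u)^{1/2}\cos(\phi-\theta),\qquad \frac{d\phi_j}{ds}=-\frac{\lambda_jQ(u)^{1/2}\sin(\phi-\theta)}{\alpha_j+\lambda_ju}\ \ (j=1,\ldots,n-1),$$ $$\frac{d\phi}{ds}=-Q(u)^{1/2}(\ln Q(u))'\sin(\phi-\theta),\qquad \frac{d\theta}{ds}=\alpha Q(u)^{1/2}\sin(\phi-\theta),$$ and, for some $A\in\mathbb{R}$, $Q(u)^{1/2}e^{\alpha u/2}\sin(\phi-\theta)\equiv A$.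
   Context: Write $w_j=r_je^{i\phi_j}$ with $r_j:I\to(0,\infty)$ and $\phi_j$ smooth ($j=1,\ldots,n-1$), $\phi=\sum_{j=1}^{n-1}\phi_j$. Fix $s_0\in I$ and set $\alpha_j=r_j(s_0)^2$ and $u(s)=2\int_{s_0}^sr_1(t)\cdots r_{n-1}(t)\cos(\phi(t)-\theta(t))\,dt$. $(\ln Q(u))'$ denotes the derivative in $u$ evaluated at $u=u(s)$. A Lagrangian translating soliton with translating vector $T$ is a Lagrangian submanifold with $H\equiv T^\perp$ ($H$ mean curvature vector, $T^\perp$ normal part of the constant vector $T$); here $T=(0,\ldots,0,\alpha)$. Empty products are $1$. *)

(* Defs.v *)
From HB Require Import structures.
From mathcomp Require Import all_boot all_order all_algebra.
From mathcomp Require Import complex.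
From mathcomp Require Import all_classical all_reals all_analysis.

Set Implicit Arguments.
Unset Strict Implicit.
Unset Printing Implicit Defensive.

Import Order.TTheory GRing.Theory Num.Theory.
Import numFieldNormedType.Exports.

Local Open Scope classical_set_scope.
Local Open Scope complex_scope.
Local Open Scope ring_scope.

Section OneVariable.
Variable R : realType.
Implicit Types (I : set R) (f : R -> R) (w : R -> R[i]).

(* Functions on the open interval I are represented by total functions of
   which only the values on I matter. *)
Definition smooth_on I f : Prop :=
  forall (k : nat) (s : R), I s -> derivable (derive1n k f) s 1.

Definition csmooth_on I w : Prop :=
  smooth_on I (fun s => complex.Re (w s)) /\
  smooth_on I (fun s => complex.Im (w s)).

(* w has derivative z at s.  The library has no normed R-module structure on
   R[i], hence the reduction to real and imaginary parts. *)
Definition is_cderive (s : R) w (z : R[i]) : Prop :=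
  is_derive s 1 (fun t => complex.Re (w t)) (complex.Re z) /\
  is_derive s 1 (fun t => complex.Im (w t)) (complex.Im z).

(* exp(i t) *)
Definition expi (t : R) : R[i] := cos t +i* sin t.

(* The integral of f from a to b, with the usual sign when b < a. *)
Definition oriented_integral (a b : R) f : R :=
  if a <= b then \int[lebesgue_measure]_(t in `[a, b]) f t
  else - \int[lebesgue_measure]_(t in `[b, a]) f t.

End OneVariable.

(* C^n, with its coordinates, is 'rV[R[i]]_n.  Submanifolds of C^n are given by
   an immersion F of an open subset U of R^n. *)
Section Submanifold.
Variables (R : realType) (n : nat).
Implicit Types (U : set 'rV[R]_n) (F : 'rV[R]_n -> 'rV[R[i]]_n).

Definition partial (a : 'I_n) (f : 'rV[R]_n -> R) (p : 'rV[R]_n) : R :=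
  'D_(delta_mx 0 a) f p.

(* C^infinity: every iterated partial derivative is differentiable on the open
   set U. *)
Definition multi_smooth_on U (f : 'rV[R]_n -> R) : Prop :=
  forall (l : seq 'I_n) (p : 'rV[R]_n), U p -> differentiable (foldr partial f l) p.

Definition vpartial (a : 'I_n) F (p : 'rV[R]_n) : 'rV[R[i]]_n :=
  \row_k (partial a (fun q => complex.Re (F q 0 k)) p
          +i* partial a (fun q => complex.Im (F q 0 k)) p).

(* The Euclidean metric of C^n = R^(2n). *)
Definition euclid (z w : 'rV[R[i]]_n) : R :=
  complex.Re (\sum_k z 0 k * (w 0 k)^*%C).

(* The standard symplectic form, the sum of dx_k /\ dy_k. *)
Definition symplectic (z w : 'rV[R[i]]_n) : R :=
  \sum_k (complex.Re (z 0 k) * complex.Im (w 0 k)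
          - complex.Im (z 0 k) * complex.Re (w 0 k)).

Definition immersion_on U F : Prop :=
  [/\ forall k, multi_smooth_on U (fun p => complex.Re (F p 0 k)),
      forall k, multi_smooth_on U (fun p => complex.Im (F p 0 k)) &
      forall p, U p -> forall c : 'I_n -> R,
        \sum_a (c a)%:C *: vpartial a F p = 0 -> forall a, c a = 0].

(* Since dim F = n is half of dim C^n, isotropic immersions are Lagrangian. *)
Definition lagrangian_on U F : Prop :=
  immersion_on U F /\
  forall p, U p -> forall a b, symplectic (vpartial a F p) (vpartial b F p) = 0.

Definition first_form F (p : 'rV[R]_n) : 'M[R]_n :=
  \matrix_(a, b) euclid (vpartial a F p) (vpartial b F p).

(* v minus its orthogonal projection g^{ab} <v, d_a F> d_b F to the tangent
   space. *)
Definition normal_part F (p : 'rV[R]_n) (v : 'rV[R[i]]_n) : 'rV[R[i]]_n :=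
  v - \sum_a \sum_b
        (invmx (first_form F p) a b * euclid v (vpartial a F p))%:C
          *: vpartial b F p.

(* The trace g^{ab} (d_a d_b F)^perp of the second fundamental form. *)
Definition mean_curvature F (p : 'rV[R]_n) : 'rV[R[i]]_n :=
  \sum_a \sum_b (invmx (first_form F p) a b)%:C
    *: normal_part F p (vpartial a (vpartial b F) p).

(* L is an (immersed) Lagrangian submanifold with H = T^perp; F : U -> L is its
   parametrization. *)
Definition lagrangian_translating_soliton U F (L : set 'rV[R[i]]_n)
    (T : 'rV[R[i]]_n) : Prop :=
  [/\ open U, F @` U = L, lagrangian_on U F &
      forall p, U p -> mean_curvature F p = normal_part F p T].

End Submanifold.

(* For m = n - 1 a point of R^n is (x_1, ..., x_m, s). *)
Section Soliton.
Variables (R : realType) (m : nat).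

Definition soliton_domain (I : set R) : set 'rV[R]_(m + 1) :=
  [set p | I (rsubmx p 0 0)].

Definition soliton_point (lambda : 'I_m -> R) (w : 'I_m -> R -> R[i])
    (beta : R -> R[i]) (x : 'rV[R]_m) (s : R) : 'rV[R[i]]_(m + 1) :=
  row_mx (\row_j ((x 0 j)%:C * w j s))
         (- (2^-1 * \sum_j lambda j * x 0 j ^+ 2)%:C + beta s)%:M.

Definition soliton_map lambda w beta (p : 'rV[R]_(m + 1)) : 'rV[R[i]]_(m + 1) :=
  soliton_point lambda w beta (lsubmx p) (rsubmx p 0 0).

End Soliton.

(* Main.v *)
From HB Require Import structures.
Require Import Defs.
From mathcomp Require Import all_boot all_order all_algebra.
From mathcomp Require Import complex.
From mathcomp Require Import ring lra.
From mathcomp Require Import all_classical all_reals all_analysis.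
Import Order.TTheory GRing.Theory Num.Theory.
Import numFieldNormedType.Exports.
Local Open Scope classical_set_scope.
Local Open Scope complex_scope.
Local Open Scope ring_scope.

Set Implicit Arguments.
Unset Strict Implicit.
Unset Printing Implicit Defensive.

(** Both halves of the statement are governed by one function, the velocity
   $z = \beta' = e^{i\theta}\,\overline{w_1\cdots w_m}$ with $m = n-1$.

   The soliton property. At the point with parameters $(x,s)$ let
   $l_j = \lambda_j z/|w_j|^2$, $v_j = \lambda_j x_j$ and
   $S = 1 + \sum_j v_j^2/|w_j|^2$. The equations read $w_j' = l_j w_j$, so products of the $w_j$ have logarithmic
   derivatives that are sums of the $l_j$; in particular $z' = \mu z$ with
   $\mu = i\theta' + \overline{\sum_j l_j}$. In the coordinate frame the
   Hermitian product of $\mathbb{C}^n$ takes the real value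
   $\mathrm{diag}(|w_j|^2) + vv^T$ on the $x$-directions and $|z|^2S$ on the
   $s$-direction, and vanishes between the two ([herm_tangent]). A frame with
   real Hermitian Gram matrix $g$ is isotropic, and when $g$ is invertible it is
   a complex basis, hence free over the reals. In such a frame, normal parts are
   the imaginary parts of the coordinates ([normal_partE]), so that $H = T^\perp$
   amounts to
   $g^{ab}\,\mathrm{Im}\langle\partial_a\partial_b F,\partial_c F\rangle
   = \mathrm{Im}\langle T,\partial_c F\rangle$ for each $c$
   ([mean_curvature_eq_normal_part]). The left hand side is computed from a
   symmetric cubic form ([cubic], [Im_herm_hessian]) and the Sherman-Morrison
   inverse of $g$ ([metric_inverse]). It is $0$ when $c$ is an $x$-direction. For
   the $s$-direction the terms containing $S$ cancel, which leaves
   $\mathrm{Im}\,\mu + \mathrm{Im}\,z\sum_j\lambda_j/|w_j|^2 = \theta'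
   = -\alpha\,\mathrm{Im}\,z$ ([trace_cubic]), as required by
   $T = (0,\ldots,0,\alpha)$.

   The polar form. Here $z = r_1\cdots r_m\,e^{i(\theta-\phi)}$, so the
   integrand of $u$ is $\mathrm{Re}\,\beta'$ and
   $u = 2\,\mathrm{Re}(\beta - \beta(s_0))$ on $I$ ([u_beta]). The functions
   $r_j^2 - 2\lambda_j\mathrm{Re}\,\beta$,
   $\mathrm{Im}\,\beta + \theta/\alpha$ and
   $\mathrm{Im}\,z\;e^{\alpha\mathrm{Re}\beta}$ have derivative $0$ on the
   interval $I$. They give, in this order, $r_j^2 = \alpha_j + \lambda_ju$
   ([r2_linear]), the last coordinate ([beta_polar]) and the first integral
   ([first_integral]). The remaining equations compare $z$ with
   $Q(u)^{1/2} = r_1\cdots r_m$. *)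

(** * Directional derivatives of complex-valued functions *)

Section ComplexDerivative.
Variables (R : realType) (V : normedModType R).
Implicit Types (p v : V) (F G : V -> R[i]) (x y z : R[i]).

Definition is_cderive_along p v F z : Prop :=
  is_derive p v (fun q => complex.Re (F q)) (complex.Re z) /\
  is_derive p v (fun q => complex.Im (F q)) (complex.Im z).

Lemma is_derive_congr p v (f g : V -> R) (a b : R) :
  is_derive p v f a -> f =1 g -> a = b -> is_derive p v g b.
Proof. by move=> + /funext <- <-. Qed.

Lemma is_cderive_along_congr p v F G x y :
  is_cderive_along p v F x -> F =1 G -> x = y -> is_cderive_along p v G y.
Proof. by move=> + /funext <- <-. Qed.

Lemma near_eq_is_cderive_along p v F G x :
  (\forall q \near p, F q = G q) ->
  is_cderive_along p v F x -> is_cderive_along p v G x.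
Proof.
move=> FG [Fr Fi]; split.
  by apply: near_eq_is_derive Fr; apply: filterS FG => q ->.
by apply: near_eq_is_derive Fi; apply: filterS FG => q ->.
Qed.

Lemma is_cderive_along_unique p v F x y :
  is_cderive_along p v F x -> is_cderive_along p v F y -> x = y.
Proof.
case: x y => [a b] [c d] [[_ /= Fa] [_ /= Fb]] [[_ /= Fc] [_ /= Fd]].
by rewrite -Fa -Fb -Fc -Fd.
Qed.

Lemma is_cderive_along_cst p v z : is_cderive_along p v (cst z) 0.
Proof. by split; apply: is_derive_cst. Qed.

Lemma is_cderive_alongD p v F G x y :
  is_cderive_along p v F x -> is_cderive_along p v G y ->
  is_cderive_along p v (fun q => F q + G q) (x + y).
Proof.
move=> [Fr Fi] [Gr Gi]; split.
  apply: (is_derive_congr (is_deriveD Fr Gr)) => [q|]; last first.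
    by case: x y {Fr Fi Gr Gi} => [? ?] [? ?].
  by rewrite /GRing.add /=; case: (F q) (G q) => [? ?] [? ?].
apply: (is_derive_congr (is_deriveD Fi Gi)) => [q|]; last first.
  by case: x y {Fr Fi Gr Gi} => [? ?] [? ?].
by rewrite /GRing.add /=; case: (F q) (G q) => [? ?] [? ?].
Qed.

Lemma is_cderive_alongM p v F G x y :
  is_cderive_along p v F x -> is_cderive_along p v G y ->
  is_cderive_along p v (fun q => F q * G q) (x * G p + F p * y).
Proof.
move=> [Fr Fi] [Gr Gi]; split.
  apply: (is_derive_congr (is_deriveB (is_deriveM Fr Gr) (is_deriveM Fi Gi))) => [q|].
    by rewrite /= !fctE; case: (F q) (G q) => [? ?] [? ?].
  rewrite /GRing.scale /=.
  case: x y {Fr Fi Gr Gi} (F p) (G p) => [? ?] [? ?] [? ?] [? ?] /=; ring.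
apply: (is_derive_congr (is_deriveD (is_deriveM Fr Gi) (is_deriveM Fi Gr))) => [q|].
  by rewrite /= !fctE; case: (F q) (G q) => [? ?] [? ?]; rewrite /=; ring.
rewrite /GRing.scale /=.
case: x y {Fr Fi Gr Gi} (F p) (G p) => [? ?] [? ?] [? ?] [? ?] /=; ring.
Qed.

Lemma is_cderive_alongN p v F x :
  is_cderive_along p v F x -> is_cderive_along p v (fun q => - F q) (- x).
Proof.
move=> [Fr Fi]; split.
  by apply: (is_derive_congr (is_deriveN Fr)) => [q|]; rewrite ?fctE;
  [case: (F q)|case: x {Fr Fi}].
by apply: (is_derive_congr (is_deriveN Fi)) => [q|]; rewrite ?fctE;
  [case: (F q)|case: x {Fr Fi}].
Qed.

Lemma is_cderive_along_conj p v F x :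
  is_cderive_along p v F x -> is_cderive_along p v (fun q => (F q)^*) x^*.
Proof.
move=> [Fr Fi]; split.
  by apply: (is_derive_congr Fr) => [q|]; [case: (F q)|case: x {Fr Fi}].
by apply: (is_derive_congr (is_deriveN Fi)) => [q|]; rewrite ?fctE;
  [case: (F q)|case: x {Fr Fi}].
Qed.

Lemma is_cderive_along_real p v (f : V -> R) (a : R) :
  is_derive p v f a -> is_cderive_along p v (fun q => (f q)%:C) a%:C.
Proof. by move=> fa; split => //=; apply: is_derive_cst. Qed.

Lemma is_cderive_along_sum (m : nat) p v (F : 'I_m -> V -> R[i]) (z : 'I_m -> R[i]) :
  (forall k, is_cderive_along p v (F k) (z k)) ->
  is_cderive_along p v (fun q => \sum_k F k q) (\sum_k z k).
Proof.
move=> Fz; elim: (index_enum _) => [|k s ih].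
  apply: (is_cderive_along_congr (is_cderive_along_cst p v 0)) => [q|];
  by rewrite big_nil.
apply: (is_cderive_along_congr (is_cderive_alongD (Fz k) ih)) => [q|];
by rewrite big_cons.
Qed.

(** Logarithmic derivatives add up, and multiplying them out instead of dividing
   by the factors makes the rule valid at zeros too. *)
Lemma is_cderive_along_prod (m : nat) (P : pred 'I_m) p v
    (F : 'I_m -> V -> R[i]) (l : 'I_m -> R[i]) :
  (forall k, is_cderive_along p v (F k) (l k * F k p)) ->
  is_cderive_along p v (fun q => \prod_(k | P k) F k q)
    ((\sum_(k | P k) l k) * \prod_(k | P k) F k p).
Proof.
move=> Fl; elim: (index_enum _) => [|k s ih].
  apply: (is_cderive_along_congr (is_cderive_along_cst p v 1)) => [q|];
  by rewrite !big_nil ?mul0r.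
case Pk : (P k); last first.
  by apply: (is_cderive_along_congr ih) => [q|]; rewrite !big_cons Pk.
apply: (is_cderive_along_congr (is_cderive_alongM (Fl k) ih)) => [q|];
rewrite !big_cons Pk //; ring.
Qed.

End ComplexDerivative.

Lemma is_cderive_expi (R : realType) (f : R -> R) (s a : R) :
  is_derive s 1 f a ->
  is_cderive s (fun t => expi (f t)) ('i * a%:C * expi (f s)).
Proof.
move=> fa; split.
  apply: (is_derive_congr (is_derive1_comp (is_derive_cos (f s)) fa)) => //=.
  ring.
apply: (is_derive_congr (is_derive1_comp (is_derive_sin (f s)) fa)) => //=.
ring.
Qed.

(** * Derivatives of coordinate functions *)

Section Coordinates.
Variables (R : realType) (n : nat).
Implicit Types (p v : 'rV[R]_n) (a : 'I_n).

Lemma is_derive_coord p v a : is_derive p v (fun q : 'rV[R]_n => q 0 a : R) (v 0 a).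
Proof.
have d := @differentiable_coord R 1 n p 0 a.
apply: DeriveDef; first exact: diff_derivable.
rewrite deriveE//.
have f_linear : linear_for *%R (fun q : 'rV[R]_n => q 0 a : R)
  by move=> c x y; rewrite !mxE.
pose f : {linear 'rV[R]_n -> R} := HB.pack (fun q : 'rV[R]_n => q 0 a : R)
   (GRing.isLinear.Build R _ R *%R (fun q : 'rV[R]_n => q 0 a : R) f_linear).
rewrite (_ : (fun _ => _) = f)//.
rewrite diff_lin//.
exact: coord_continuous.
Qed.

Lemma differentiable_comp_coord (h : R -> R) p a :
  derivable h (p 0 a) 1 -> differentiable (fun q : 'rV[R]_n => h (q 0 a)) p.
Proof.
move=> hd; apply: (@differentiable_comp _ _ _ _ (fun q : 'rV[R]_n => q 0 a : R) h).
  exact: differentiable_coord.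
exact/derivable1_diffP.
Qed.

Lemma is_derive_comp_coord (h : R -> R) p v a (d : R) :
  is_derive (p 0 a) 1 h d -> is_derive p v (fun q : 'rV[R]_n => h (q 0 a)) (v 0 a * d).
Proof.
move=> hd.
have dh : differentiable h (p 0 a) by apply/derivable1_diffP; case: hd.
have dc : differentiable (fun q : 'rV[R]_n => q 0 a : R) p.
  exact: differentiable_coord.
have d' := @differentiable_comp_coord h p a (@ex_derive _ _ _ _ _ _ _ hd).
apply: DeriveDef; first exact: diff_derivable.
rewrite deriveE//.
rewrite (@diff_comp _ _ _ _ (fun q : 'rV[R]_n => q 0 a : R) h)//=.
have [_ <-] := is_derive_coord p v a.
rewrite -(@deriveE _ _ _ (fun q : 'rV[R]_n => q 0 a : R)) //.
have [_ ->] := is_derive_coord p v a.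
case: hd => _ <-.
rewrite deriveE//.
by rewrite -[in LHS](mulr1 (v 0 a)); exact: linearZ.
Qed.

End Coordinates.

(** * Smooth functions of several variables *)

(** Differentiability at a point is stated by a global equation with a little-o
   remainder; only the germ of the function enters the remainder. *)
Lemma near_eq_differentiable (R : realType) (V W : normedModType R)
    (f g : V -> W) (p : V) :
  (\forall q \near p, f q = g q) -> differentiable f p -> differentiable g p.
Proof.
move=> fg df; have [dfc fE] := (diff_locallyP p f).1 df.
have gE : g \o shift p = cst (g p) + 'd f p +o_0 id.
  apply/eqaddoP => e e0; have /eqaddoP /(_ e e0) fo := fE.
  have fg0 : \forall h \near 0, f (h + p) = g (h + p).
    by move: fg; rewrite (near_shift 0 p) subr0.
  near=> h.
  have -> : (g \o shift p - (cst (g p) + 'd f p)) h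
      = (f \o shift p - (cst (f p) + 'd f p)) h.
    rewrite /= !fctE /= (nbhs_singleton fg); congr (_ - _).
    by apply/esym; near: h.
  by near: h.
have dgE : 'd g p = 'd f p :> (V -> W) by exact: diff_unique.
by apply/diff_locallyP; rewrite dgE.
Unshelve. all: by end_near. Qed.

Section SmoothFunctions.
Variables (R : realType) (n : nat) (I : set R) (c : 'I_n).
Hypothesis I_open : open I.

Let U : set 'rV[R]_n := [set p | I (p 0 c)].

Lemma slab_open : open U.
Proof.
by move: I_open; apply: open_comp => p _; exact: coord_continuous.
Qed.

(** Induction on the iterated derivatives in [multi_smooth_on] needs a class of
   differentiable functions that is closed under partial derivation. The last
   constructor is what closes it: a partial derivative is computed only on the
   open set [U], whereas [smooth_on] says nothing about a function outside [I]. *)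
Inductive elementary : ('rV[R]_n -> R) -> Prop :=
| elementary_cst (k : R) : elementary (fun=> k)
| elementary_coord a : elementary (fun p : 'rV[R]_n => p 0 a)
| elementary_lift h : smooth_on I h -> elementary (fun p => h (p 0 c))
| elementaryD f g :
    elementary f -> elementary g -> elementary (fun p => f p + g p)
| elementaryM f g :
    elementary f -> elementary g -> elementary (fun p => f p * g p)
| elementary_eq f g :
    elementary f -> (forall p, U p -> f p = g p) -> elementary g.

Lemma near_slab p : U p -> \forall q \near p, U q.
Proof. by move=> Up; apply: open_nbhs_nbhs; split=> //; exact: slab_open. Qed.

Lemma elementary_differentiable f p : elementary f -> U p -> differentiable f p.
Proof.
move=> ef Up; elim: ef => [k|a|h hI|g h _ dg _ dh|g h _ dg _ dh|g h _ dg gh].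
- exact: differentiable_cst.
- exact: differentiable_coord.
- by apply: differentiable_comp_coord; exact: (hI 0%N).
- exact: differentiableD.
- exact: differentiableM.
- by apply: near_eq_differentiable dg; apply: filterS (near_slab Up).
Qed.

Lemma smooth_on_derive1 (h : R -> R) : smooth_on I h -> smooth_on I (derive1 h).
Proof. by move=> hI k s Is; have := hI k.+1 s Is; rewrite derive1Sn. Qed.

Lemma elementary_partial f a : elementary f -> elementary (partial a f).
Proof.
elim=> [k|b|h hI|g h eg dg eh dh|g h eg dg eh dh|g h eg dg gh].
- apply: elementary_eq (elementary_cst 0) _ => p _.
  by rewrite /partial derive_cst.
- apply: elementary_eq (elementary_cst (delta_mx 0 a 0 b)) _ => p _.
  exact/esym/derive_val/is_derive_coord.
- apply: elementary_eq (elementaryM (elementary_cst (delta_mx 0 a 0 c))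
      (elementary_lift (smooth_on_derive1 hI))) _ => p Up.
  have hd : is_derive (p 0 c) 1 h (derive1 h (p 0 c)).
    by rewrite derive1E; apply: derivableP; exact: (hI 0%N).
  by apply/esym/derive_val; exact: is_derive_comp_coord.
- apply: elementary_eq (elementaryD dg dh) _ => p Up.
  rewrite /partial -deriveD //; apply: diff_derivable;
  exact: elementary_differentiable.
- apply: elementary_eq (elementaryD (elementaryM eg dh) (elementaryM eh dg)) _ => p Up.
  rewrite /partial [RHS]deriveM //; apply: diff_derivable;
  exact: elementary_differentiable.
- apply: elementary_eq dg _ => p Up.
  by apply: near_eq_derive; apply: filterS (near_slab Up).
Qed.

Lemma elementary_multi_smooth f : elementary f -> multi_smooth_on U f.
Proof.
move=> ef l p Up; apply: elementary_differentiable => //.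
by elim: l => //= a l ih; exact: elementary_partial.
Qed.

Lemma elementary_sum (m : nat) (f : 'I_m -> 'rV[R]_n -> R) :
  (forall k, elementary (f k)) -> elementary (fun p => \sum_k f k p).
Proof.
move=> ef; elim: (index_enum _) => [|k s ih].
  by apply: elementary_eq (elementary_cst 0) _ => p _; rewrite big_nil.
by apply: elementary_eq (elementaryD (ef k) ih) _ => p _; rewrite big_cons.
Qed.

End SmoothFunctions.

(** * The normal bundle of a Lagrangian immersion *)

Section Hermitian.
Variables (R : realType) (n : nat).
Implicit Types (u v : 'rV[R[i]]_n) (F : 'rV[R]_n -> 'rV[R[i]]_n) (p : 'rV[R]_n).

Definition herm u v : R[i] := \sum_k u 0 k * (v 0 k)^*.

Lemma Im_sum (T : Type) (s : seq T) (f : T -> R[i]) :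
  complex.Im (\sum_(k <- s) f k) = \sum_(k <- s) complex.Im (f k).
Proof.
elim: s => [|k s ih]; first by rewrite !big_nil.
by rewrite !big_cons -ih; case: (f k) (\sum_(_ <- _) _) => [? ?] [? ?].
Qed.

Lemma euclidE u v : euclid u v = complex.Re (herm u v).
Proof. by []. Qed.

Lemma symplecticE u v : symplectic u v = - complex.Im (herm u v).
Proof.
rewrite /symplectic Im_sum -sumrN; apply: eq_bigr => k _.
by case: (u 0 k) (v 0 k) => [a b] [c d] /=; ring.
Qed.

Section Frame.
Variables (F : 'rV[R]_n -> 'rV[R[i]]_n) (p : 'rV[R]_n).
Hypothesis isotropic :
  forall a b, complex.Im (herm (vpartial a F p) (vpartial b F p)) = 0.
Hypothesis form_unit : first_form F p \in unitmx.

Let g := first_form F p.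
Let frame : 'M[R[i]]_n := \matrix_a vpartial a F p.

(* The normal vector N with h_a = Im <N, d_a F> for all a. *)
Let normal_of (h : 'rV[R]_n) : 'rV[R[i]]_n :=
  'i%C *: (map_mx (real_complex R) (h *m invmx g) *m frame).

Let frameV : 'M[R[i]]_n :=
  (map_mx conjc frame)^T *m map_mx (real_complex R) (invmx g).

Lemma mul_frameV : frame *m frameV = 1%:M.
Proof.
have gE : frame *m (map_mx conjc frame)^T = map_mx (real_complex R) g.
  apply/matrixP => a b; rewrite !mxE [RHS]complexE /= euclidE.
  rewrite [X in X = _](_ : _ = herm (vpartial a F p) (vpartial b F p)); last first.
    by apply: eq_bigr => k _; rewrite !mxE.
  by rewrite [LHS]complexE isotropic.
by rewrite mulmxA gE -map_mxM mulmxV //; exact: map_mx1.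
Qed.

Lemma frame_expansion (u : 'rV[R[i]]_n) :
  u = (\row_a herm u (vpartial a F p))
      *m map_mx (real_complex R) (invmx g) *m frame.
Proof.
rewrite -[LHS]mulmx1 -(mulmx1C mul_frameV) !mulmxA; congr (_ *m _ *m _).
by apply/rowP => a; rewrite !mxE; apply: eq_bigr => k _; rewrite !mxE.
Qed.

(** In a Lagrangian frame the Gram matrix of the Hermitian product is the real
   matrix [g], so that the expansion of a vector in this frame splits into its
   tangent part (real coefficients) and its normal part (imaginary ones). *)
Lemma normal_partE u :
  normal_part F p u = normal_of (\row_a complex.Im (herm u (vpartial a F p))).
Proof.
rewrite /normal_part {1}(frame_expansion u).
set X := \sum_a _.
have -> : X = map_mx (real_complex R)
    ((\row_a complex.Re (herm u (vpartial a F p))) *m invmx g) *m frame.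
  rewrite /X exchange_big /=; apply/rowP => k; rewrite mxE summxE.
  apply: eq_bigr => b _; rewrite summxE !mxE rmorph_sum mulr_suml.
  by apply: eq_bigr => a _; rewrite !mxE euclidE [X in X%:C * _]mulrC.
rewrite /normal_of -mulmxBl scalemxAl; congr (_ *m _).
have mapM (h : 'rV[R]_n) : map_mx (real_complex R) (h *m invmx g)
    = map_mx (real_complex R) h *m map_mx (real_complex R) (invmx g).
  exact: map_mxM.
rewrite !mapM scalemxAl -mulmxBl.
congr (_ *m _); apply/rowP => a; rewrite !mxE.
by rewrite {1}[herm _ _]complexE addrC addKr.
Qed.

(** [normal_partE] turns both sides into images of real rows under the same linear
   map, so it suffices to compare these rows entry by entry. *)
Lemma mean_curvature_eq_normal_part (T : 'rV[R[i]]_n) :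
  (forall c, \sum_a \sum_b invmx g a b
     * complex.Im (herm (vpartial a (vpartial b F) p) (vpartial c F p))
   = complex.Im (herm T (vpartial c F p))) ->
  mean_curvature F p = normal_part F p T.
Proof.
move=> curv; rewrite normal_partE.
have -> : \row_a complex.Im (herm T (vpartial a F p))
  = \sum_a \sum_b invmx g a b *: \row_c
      complex.Im (herm (vpartial a (vpartial b F) p) (vpartial c F p)).
  apply/rowP => c; rewrite mxE -curv summxE; apply: eq_bigr => a _.
  by rewrite summxE; apply: eq_bigr => b _; rewrite !mxE.
have normal_sum (f : 'I_n -> 'rV[R]_n) :
    normal_of (\sum_a f a) = \sum_a normal_of (f a).
  by rewrite /normal_of mulmx_suml raddf_sum mulmx_suml scaler_sumr.
rewrite normal_sum; apply: eq_bigr => a _; rewrite normal_sum.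
apply: eq_bigr => b _.
rewrite normal_partE /normal_of -scalemxAl map_mxZ -scalemxAl.
by rewrite !scalerA mulrC.
Qed.

(** A relation between the tangent vectors is in the left kernel of the frame,
   which has a right inverse. *)
Lemma frame_free (c : 'I_n -> R) :
  \sum_a (c a)%:C *: vpartial a F p = 0 -> forall a, c a = 0.
Proof.
move=> c0; pose r : 'rV[R]_n := \row_a c a.
have rE : map_mx (real_complex R) r *m frame = 0.
  rewrite -[RHS]c0; apply/rowP => k; rewrite mxE summxE.
  by apply: eq_bigr => a _; rewrite !mxE.
have r0 : map_mx (real_complex R) r = 0.
  by rewrite -[LHS]mulmx1 -mul_frameV mulmxA rE mul0mx.
move=> a; have /rowP/(_ a) := r0.
by rewrite !mxE => -[].
Qed.

End Frame.
End Hermitian.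

(** * The soliton immersion *)

Section SquaredModulus.
Variable R : realType.

Definition sqmod (z : R[i]) : R := complex.Re z ^+ 2 + complex.Im z ^+ 2.

Lemma mul_conjc (z : R[i]) : z * z^* = (sqmod z)%:C.
Proof.
case: z => a b; apply/eqP; rewrite eq_complex /sqmod /=.
by apply/andP; split; apply/eqP; ring.
Qed.

Lemma sqmod_gt0 (z : R[i]) : z != 0 -> 0 < sqmod z.
Proof.
case: z => a b; rewrite eq_complex /= negb_and /sqmod /= => /orP[] h0.
  by rewrite ltr_pwDl ?sqr_ge0 // exprn_even_gt0.
by rewrite ltr_wpDl ?sqr_ge0 // exprn_even_gt0.
Qed.

Lemma sqmod_expi (t : R) : sqmod (expi t) = 1.
Proof. by rewrite /sqmod /= cos2Dsin2. Qed.

End SquaredModulus.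

Lemma is_cderive_along_comp_coord (R : realType) (n : nat) (h : R -> R[i])
    (p v : 'rV[R]_n) (c : 'I_n) (z : R[i]) :
  is_cderive (p 0 c) h z ->
  is_cderive_along p v (fun q : 'rV[R]_n => h (q 0 c)) ((v 0 c)%:C * z).
Proof.
move=> [hr hi]; split.
  apply: is_derive_congr (is_derive_comp_coord v hr) _ _ => //.
  by case: z {hr hi} => a b /=; ring.
apply: is_derive_congr (is_derive_comp_coord v hi) _ _ => //.
by case: z {hr hi} => a b /=; ring.
Qed.

Lemma vpartial_along (R : realType) (n : nat) (F : 'rV[R]_n -> 'rV[R[i]]_n)
    (p : 'rV[R]_n) (a : 'I_n) (G : 'rV[R[i]]_n) :
  (forall k, is_cderive_along p (delta_mx 0 a) (fun q => F q 0 k) (G 0 k)) ->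
  vpartial a F p = G.
Proof.
move=> FG; apply/rowP => k; rewrite mxE.
by have [[_ Fr] [_ Fi]] := FG k; rewrite /partial Fr Fi; case: (G 0 k).
Qed.

Section Immersion.
Variables (R : realType) (m : nat) (I : set R).
Variables (lambda : 'I_m -> R) (alpha : R) (theta : R -> R).
Variables (w : 'I_m -> R -> R[i]) (beta : R -> R[i]).
Hypothesis I_open : open I.
Hypothesis w_smooth : forall j, csmooth_on I (w j).
Hypothesis w_neq0 : forall j s, I s -> w j s != 0.
Hypothesis beta_smooth : csmooth_on I beta.
Hypothesis w_ode : forall j s, I s -> is_cderive s (w j)
  ((lambda j)%:C * expi (theta s) * (\prod_(k < m | k != j) w k s)^*%C).
Hypothesis theta_ode : forall s, I s -> is_derive s 1 theta
  (alpha * complex.Im (expi (- theta s) * \prod_(k < m) w k s)).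
Hypothesis beta_ode : forall s, I s ->
  is_cderive s beta (expi (theta s) * (\prod_(k < m) w k s)^*%C).

Let F := soliton_map lambda w beta.
Let U := [set p : 'rV[R]_(m + 1) | I (p 0 (rshift m 0))].

Definition velocity s : R[i] := expi (theta s) * (\prod_(k < m) w k s)^*%C.
Local Notation z := velocity.

Lemma velocity_neq0 s : I s -> z s != 0.
Proof.
move=> Is; rewrite mulf_neq0 //.
  apply: contraTneq (oner_neq0 R) => e0.
  by rewrite -(sqmod_expi (theta s)) e0 /sqmod /= expr0n addr0 eqxx.
by rewrite conjc_eq0; apply/prodf_neq0 => k _; exact: w_neq0.
Qed.

Let d j s := sqmod (w j s).
Let d_gt0 j s (Is : I s) : 0 < d j s := sqmod_gt0 (w_neq0 j Is).

Definition log_rate j s : R[i] := (lambda j / d j s)%:C * z s.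

(** $\overline{\prod_{k\neq j}w_k} = \overline{\prod_k w_k}\,w_j/|w_j|^2$. *)
Lemma w_ode_log j s : I s -> is_cderive s (w j) (log_rate j s * w j s).
Proof.
move=> Is; suff -> : log_rate j s * w j s
    = (lambda j)%:C * expi (theta s) * (\prod_(k < m | k != j) w k s)^*%C.
  exact: w_ode.
rewrite /log_rate /velocity (bigD1 j) //= [in LHS]rmorphM.
transitivity ((lambda j)%:C * expi (theta s) * (\prod_(k < m | k != j) w k s)^*%C
    * ((d j s)^-1%:C * (w j s * (w j s)^*))).
  by rewrite rmorphM /=; ring.
by rewrite mul_conjc -rmorphM /= mulVf ?mulr1 // gt_eqF // d_gt0.
Qed.

(** $\mu = z'/z$. *)
Definition velocity_rate s : R[i] :=
  'i * (- alpha * complex.Im (z s))%:C + (\sum_k log_rate k s)^*.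

Lemma theta_ode_velocity s : I s -> is_derive s 1 theta (- alpha * complex.Im (z s)).
Proof.
move=> Is; suff -> : - alpha * complex.Im (z s)
    = alpha * complex.Im (expi (- theta s) * \prod_(k < m) w k s).
  exact: theta_ode.
rewrite /velocity /expi cosN sinN; case: (\prod_(k < m) w k s) => a b /=; ring.
Qed.

Lemma Im_velocity_rate s : complex.Im (velocity_rate s) =
  - alpha * complex.Im (z s) - complex.Im (z s) * \sum_k lambda k / d k s.
Proof.
rewrite /velocity_rate.
have -> : \sum_k log_rate k s = (\sum_k lambda k / d k s)%:C * z s.
  by rewrite rmorph_sum mulr_suml.
by case: (z s) => a b /=; ring.
Qed.

(** The full product gives the velocity; the product without the factor [j]
   gives $w_j'/\lambda_j$, whose derivative enters the second differential. *)
Lemma is_cderive_phase_prod (P : pred 'I_m) s : I s ->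
  is_cderive s (fun t => expi (theta t) * (\prod_(k < m | P k) w k t)^*)
    (expi (theta s) * (\prod_(k < m | P k) w k s)^*
     * ('i * (- alpha * complex.Im (z s))%:C + (\sum_(k | P k) log_rate k s)^*)).
Proof.
move=> Is.
have dp := is_cderive_along_prod P (fun k => w_ode_log k Is).
have dc := is_cderive_along_conj dp.
have de := is_cderive_expi (theta_ode_velocity Is).
apply: is_cderive_along_congr (is_cderive_alongM de dc) _ _ => //.
rewrite [X in _ + _ * X]rmorphM /=; ring.
Qed.

Lemma velocity_derive s : I s -> is_cderive s z (z s * velocity_rate s).
Proof. by move=> Is; exact: (is_cderive_phase_prod predT Is). Qed.

Lemma w_derive2 j s : I s ->
  is_cderive s (fun t => (lambda j)%:C * expi (theta t)
                         * (\prod_(k < m | k != j) w k t)^*%C)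
   (log_rate j s * w j s * (velocity_rate s - (log_rate j s)^*)).
Proof.
move=> Is; have dc := is_cderive_along_cst (s : R) 1 (lambda j)%:C.
apply: is_cderive_along_congr (is_cderive_alongM dc
  (is_cderive_phase_prod (fun k => k != j) Is)) _ _.
  by move=> t /=; rewrite mulrA.
have <- := is_cderive_along_unique (w_ode j Is) (w_ode_log j Is).
rewrite /velocity_rate.
have -> : \sum_k log_rate k s = log_rate j s + \sum_(k | k != j) log_rate k s.
  by rewrite (bigD1 j).
have conjD (x y : R[i]) : (x + y)^* = x^* + y^* by exact: rmorphD.
rewrite conjD /=; ring.
Qed.

(** The differential of the immersion at [p], applied to [v], after substitution
   of the differential equations for the derivatives of the $w_j$ and $\beta$. *)
Definition tangent (p v : 'rV[R]_(m + 1)) : 'rV[R[i]]_(m + 1) :=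
  let s := p 0 (rshift m 0) in
  row_mx (\row_j ((v 0 (lshift 1 j))%:C * w j s
      + (p 0 (lshift 1 j))%:C * ((v 0 (rshift m 0))%:C * (log_rate j s * w j s))))
    ((v 0 (rshift m 0))%:C * z s
     - (\sum_j lambda j * p 0 (lshift 1 j) * v 0 (lshift 1 j))%:C)%:M.

(** The second differential, as a symmetric bilinear form, after substitution of
   the second derivatives of the $w_j$ and $\beta$. *)
Definition hessian (p v v' : 'rV[R]_(m + 1)) : 'rV[R[i]]_(m + 1) :=
  let s := p 0 (rshift m 0) in
  row_mx (\row_j ((v 0 (lshift 1 j) * v' 0 (rshift m 0)
       + v' 0 (lshift 1 j) * v 0 (rshift m 0))%:C * (log_rate j s * w j s)
      + (p 0 (lshift 1 j) * v 0 (rshift m 0) * v' 0 (rshift m 0))%:C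
        * (log_rate j s * w j s * (velocity_rate s - (log_rate j s)^*))))
    ((v 0 (rshift m 0) * v' 0 (rshift m 0))%:C * (z s * velocity_rate s)
     - (\sum_j lambda j * v 0 (lshift 1 j) * v' 0 (lshift 1 j))%:C)%:M.

Lemma is_cderive_along_coord (p v : 'rV[R]_(m + 1)) a :
  is_cderive_along p v (fun q : 'rV[R]_(m + 1) => (q 0 a)%:C) (v 0 a)%:C.
Proof. by apply: is_cderive_along_real; exact: is_derive_coord. Qed.

Lemma soliton_map_l (p : 'rV[R]_(m + 1)) j :
  F p 0 (lshift 1 j) = (p 0 (lshift 1 j))%:C * w j (p 0 (rshift m 0)).
Proof. by rewrite /F /soliton_map /soliton_point row_mxEl !mxE. Qed.

Lemma soliton_map_r (p : 'rV[R]_(m + 1)) :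
  F p 0 (rshift m 0) =
  - (2^-1 * \sum_j lambda j * p 0 (lshift 1 j) ^+ 2)%:C + beta (p 0 (rshift m 0)).
Proof.
rewrite /F /soliton_map /soliton_point row_mxEr !mxE eqxx mulr1n.
by congr (- (2^-1 * _)%:C + _); apply: eq_bigr => j _; rewrite mxE.
Qed.

Lemma ord_split_ind (P : 'I_(m + 1) -> Prop) :
  (forall j, P (lshift 1 j)) -> P (rshift m 0) -> forall a, P a.
Proof. by move=> Pl Pr a; case: (split_ordP a) => j ->; rewrite // (ord1 j). Qed.

Lemma soliton_map_derive (p v : 'rV[R]_(m + 1)) k : U p ->
  is_cderive_along p v (fun q => F q 0 k) (tangent p v 0 k).
Proof.
move=> Up; elim/ord_split_ind: k => [j|].
  apply: is_cderive_along_congr (is_cderive_alongM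
    (is_cderive_along_coord p v (lshift 1 j))
    (is_cderive_along_comp_coord v (w_ode_log j Up))) _ _ => [q|].
    by rewrite soliton_map_l.
  by rewrite /tangent row_mxEl mxE.
have dsq j : is_derive p v (fun q : 'rV[R]_(m + 1) => lambda j * q 0 (lshift 1 j) ^+ 2)
    (2 * (lambda j * p 0 (lshift 1 j) * v 0 (lshift 1 j))).
  have dc := is_derive_coord p v (lshift 1 j).
  have dk := is_derive_cst (lambda j) p v.
  apply: is_derive_congr (is_deriveM dk (is_deriveM dc dc)) _ _ => [q|].
    by rewrite !fctE.
  rewrite /GRing.scale /=; ring.
have dsum := is_cderive_along_sum (fun j => is_cderive_along_real (dsq j)).
have d2 := is_cderive_along_cst p v (- (2^-1)%:C : R[i]).
apply: is_cderive_along_congr (is_cderive_alongD (is_cderive_alongM d2 dsum)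
  (is_cderive_along_comp_coord v (beta_ode Up))) _ _ => [q|].
  by rewrite soliton_map_r /= -rmorph_sum mulNr -rmorphM.
rewrite /tangent row_mxEr mxE eqxx mulr1n mul0r add0r addrC; congr (_ + _).
rewrite -rmorph_sum -mulr_sumr -rmorphN -rmorphM -rmorphN; congr (_%:C).
by rewrite mulNr mulrA mulVf ?mul1r ?pnatr_eq0.
Qed.

Lemma tangent_derive (p v v' : 'rV[R]_(m + 1)) k : U p ->
  is_cderive_along p v' (fun q => tangent q v 0 k) (hessian p v v' 0 k).
Proof.
move=> Up.
elim/ord_split_ind: k => [j|].
  have dwl : is_cderive (p 0 (rshift m 0)) (fun s => log_rate j s * w j s)
      (log_rate j (p 0 (rshift m 0)) * w j (p 0 (rshift m 0))
       * (velocity_rate (p 0 (rshift m 0)) - (log_rate j (p 0 (rshift m 0)))^*)).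
    apply: near_eq_is_cderive_along (w_derive2 j Up).
    have : \forall s \near p 0 (rshift m 0), I s by apply: open_nbhs_nbhs.
    apply: filterS => s Is.
    by have := is_cderive_along_unique (w_ode j Is) (w_ode_log j Is).
  have dw := is_cderive_along_comp_coord v' (w_ode_log j Up).
  have dv := is_cderive_along_cst p v' (v 0 (lshift 1 j))%:C.
  have ds := is_cderive_along_cst p v' (v 0 (rshift m 0))%:C.
  apply: is_cderive_along_congr (is_cderive_alongD (is_cderive_alongM dv dw)
   (is_cderive_alongM (is_cderive_along_coord p v' (lshift 1 j))
     (is_cderive_alongM ds (is_cderive_along_comp_coord v' dwl)))) _ _ => [q|].
    by rewrite /tangent row_mxEl mxE.
  rewrite /hessian row_mxEl mxE /= !(rmorphD, rmorphM) /=; ring.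
have dz := is_cderive_along_comp_coord v' (velocity_derive Up).
have ds := is_cderive_along_cst p v' (v 0 (rshift m 0))%:C.
have dx j : is_derive p v'
    (fun q : 'rV[R]_(m + 1) => lambda j * q 0 (lshift 1 j) * v 0 (lshift 1 j))
    (lambda j * v 0 (lshift 1 j) * v' 0 (lshift 1 j)).
  have dc := is_derive_coord p v' (lshift 1 j).
  have dk := is_derive_cst (lambda j) p v'.
  have dl := is_derive_cst (v 0 (lshift 1 j)) p v'.
  apply: is_derive_congr (is_deriveM (is_deriveM dk dc) dl) _ _ => [q|].
    by rewrite !fctE.
  rewrite /GRing.scale /=; ring.
have dsum := is_cderive_along_sum (fun j => is_cderive_along_real (dx j)).
apply: is_cderive_along_congr (is_cderive_alongD (is_cderive_alongM ds dz)
  (is_cderive_alongN dsum)) _ _ => [q|].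
  by rewrite /tangent row_mxEr mxE eqxx mulr1n -rmorph_sum.
rewrite /hessian row_mxEr mxE eqxx mulr1n -rmorph_sum mul0r add0r; congr (_ - _).
by rewrite mulrA -rmorphM.
Qed.

Lemma vpartial_soliton p a : U p -> vpartial a F p = tangent p (delta_mx 0 a).
Proof. by move=> Up; apply: vpartial_along => k; exact: soliton_map_derive. Qed.

Lemma vpartial2_soliton p a b : U p ->
  vpartial a (vpartial b F) p = hessian p (delta_mx 0 b) (delta_mx 0 a).
Proof.
move=> Up; apply: vpartial_along => k.
apply: near_eq_is_cderive_along (tangent_derive _ _ _ Up).
by apply: filterS (near_slab I_open Up) => q Uq; rewrite vpartial_soliton.
Qed.

Lemma herm_row_mx (a a' : 'rV[R[i]]_m) (b b' : R[i]) :
  herm (row_mx a b%:M) (row_mx a' b'%:M) = \sum_j a 0 j * (a' 0 j)^* + b * b'^*.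
Proof.
rewrite /herm big_split_ord big_ord1 !row_mxEr !mxE eqxx !mulr1n; congr (_ + _).
by apply: eq_bigr => j _; rewrite !row_mxEl.
Qed.

Section AtPoint.
Variable p : 'rV[R]_(m + 1).
Hypothesis Up : U p.

Let s := p 0 (rshift m 0).
Let x j := p 0 (lshift 1 j).
Local Notation "v .s" := (v 0 (rshift m 0)) (at level 2, format "v .s").
Local Notation "v .x j" := (v 0 (lshift 1 j)) (at level 2, j at level 1).

Let S : R := 1 + \sum_j (lambda j * x j) ^+ 2 / d j s.

Definition metric (v v' : 'rV[R]_(m + 1)) : R :=
  \sum_j d j s * v.x j * v'.x j
  + (\sum_j lambda j * x j * v.x j) * (\sum_j lambda j * x j * v'.x j)
  + v.s * v'.s * (sqmod (z s) * S).

(** The second fundamental form paired with the normal fields $i\,\partial_cF$;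
   on a Lagrangian submanifold this trilinear form is symmetric. *)
Definition cubic (v v' v'' : 'rV[R]_(m + 1)) : R :=
  complex.Im (z s) * \sum_j lambda j
    * (v.x j * v'.x j * v''.s + v.x j * v'.s * v''.x j + v.s * v'.x j * v''.x j)
  + v.s * v'.s * v''.s * (sqmod (z s) * (complex.Im (velocity_rate s) * S
     + complex.Im (z s) * \sum_j lambda j * (lambda j * x j / d j s) ^+ 2)).

Lemma d_neq0 j : d j s != 0. Proof. by rewrite gt_eqF // d_gt0. Qed.

(** The terms of order one in the $s$-components cancel because
   $w_j'\,\overline{w_j} = \lambda_j z$. *)
Lemma herm_tangent v v' : herm (tangent p v) (tangent p v') = (metric v v')%:C.
Proof.
rewrite /tangent herm_row_mx /metric -/s.
have termE j :
  (\row_j ((v.x j)%:C * w j s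
            + (x j)%:C * ((v.s)%:C * (log_rate j s * w j s)))) 0 j
   * ((\row_j ((v'.x j)%:C * w j s
            + (x j)%:C * ((v'.s)%:C * (log_rate j s * w j s)))) 0 j)^*
  = (d j s * v.x j * v'.x j)%:C + v'.s%:C * (z s)^* * (lambda j * x j * v.x j)%:C
   + v.s%:C * z s * (lambda j * x j * v'.x j)%:C
   + (v.s * v'.s * sqmod (z s))%:C * ((lambda j * x j) ^+ 2 / d j s)%:C.
  rewrite !mxE /log_rate; have := d_neq0 j; rewrite /d /sqmod.
  case: (w j s) (z s) => [a b] [e f] /= n0.
  by apply/eqP; rewrite eq_complex /=; apply/andP; split; apply/eqP; field.
rewrite (eq_bigr _ (fun j _ => termE j)) !big_split /= -!mulr_sumr -!rmorph_sum.
rewrite -/x /S.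
set A := \sum_j d j s * _ * _; set B := \sum_j lambda j * x j * v.x j.
set B' := \sum_j lambda j * x j * v'.x j; set E := \sum_j _ / _.
rewrite /sqmod; case: (z s) => e f /=.
by apply/eqP; rewrite eq_complex /=; apply/andP; split; apply/eqP; ring.
Qed.

Lemma Im_herm_hessian v v' v'' :
  complex.Im (herm (hessian p v v') (tangent p v'')) = cubic v v' v''.
Proof.
rewrite /tangent /hessian herm_row_mx /cubic -/s.
move: (velocity_rate s) => r.
set T := \sum_j _ * _^*.
have TE : complex.Im T = complex.Im (z s) *
   (\sum_j lambda j * (v.x j * v'.s * v''.x j + v.s * v'.x j * v''.x j))
   + v.s * v'.s * complex.Im (z s * r) * (\sum_j lambda j * x j * v''.x j)
   + v.s * v'.s * v''.s * sqmod (z s) *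
     (complex.Im r * (\sum_j (lambda j * x j) ^+ 2 / d j s)
     + complex.Im (z s) * \sum_j lambda j * (lambda j * x j / d j s) ^+ 2).
  rewrite /T Im_sum !mulr_sumr -!big_split /=.
  rewrite !mulr_sumr -!big_split /=.
  apply: eq_bigr => j _; rewrite !mxE -/(x j) /log_rate; have := d_neq0 j.
  rewrite /d /sqmod.
  by clear T; case: r (w j s) (z s) => [g h] [a b] [e f] /= n0; field.
rewrite -/x.
have -> : \sum_j lambda j * (v.x j * v'.x j * v''.s + v.x j * v'.s * v''.x j
                             + v.s * v'.x j * v''.x j)
  = v''.s * (\sum_j lambda j * v.x j * v'.x j)
   + \sum_j lambda j * (v.x j * v'.s * v''.x j + v.s * v'.x j * v''.x j).
  by rewrite mulr_sumr -big_split; apply: eq_bigr => j _ /=; ring.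
have ImD (a b : R[i]) : complex.Im (a + b) = complex.Im a + complex.Im b.
  by case: a b => [? ?] [? ?].
rewrite ImD {}TE {T} /S /sqmod.
set A := \sum_j lambda j * (_ + _); set B := \sum_j lambda j * x j * v''.x j.
set A' := \sum_j lambda j * v.x j * v'.x j; set E := \sum_j _ / _.
set E' := \sum_j lambda j * (_ / _) ^+ 2.
case: (z s) r => [e f] [g h] /=; ring.
Qed.

Lemma delta_xx j k : (delta_mx 0 (lshift 1 j) : 'rV[R]_(m + 1)).x k = (k == j)%:R.
Proof. by rewrite mxE eqxx eq_lshift. Qed.
Lemma delta_xs j : (delta_mx 0 (lshift 1 j) : 'rV[R]_(m + 1)).s = 0.
Proof. by rewrite mxE eqxx eq_rlshift. Qed.
Lemma delta_sx k : (delta_mx 0 (rshift m 0) : 'rV[R]_(m + 1)).x k = 0.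
Proof. by rewrite mxE eqxx eq_lrshift. Qed.
Lemma delta_ss : (delta_mx 0 (rshift m 0) : 'rV[R]_(m + 1)).s = 1.
Proof. by rewrite mxE eqxx eq_rshift. Qed.
Let deltaE := (delta_xx, delta_xs, delta_sx, delta_ss).

Lemma sum_delta (f : 'I_m -> R) j : \sum_k f k * (k == j)%:R = f j.
Proof.
rewrite (bigD1 j) //= eqxx mulr1 big1 ?addr0 // => k /negPf ->.
by rewrite mulr0.
Qed.

Lemma S_gt0 : 0 < S.
Proof.
rewrite ltr_pwDl ?ltr01 // sumr_ge0 // => j _.
by rewrite divr_ge0 ?sqr_ge0 // ltW // d_gt0.
Qed.

(** [metric] in the coordinate basis. *)
Definition metric_mx : 'M[R]_(m + 1) :=
  block_mx
    (\matrix_(j, k) (d j s * (j == k)%:R + lambda j * x j * (lambda k * x k))) 0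
    0 (sqmod (z s) * S)%:M.

(** The upper left block of [metric_mx] is a rank one perturbation of a diagonal
   matrix, inverted by the Sherman-Morrison formula. *)
Definition inverse_metric : 'M[R]_(m + 1) :=
  block_mx
    (\matrix_(j, k) ((j == k)%:R / d j s
       - lambda j * x j / d j s * (lambda k * x k / d k s) / S)) 0
    0 ((sqmod (z s) * S)^-1)%:M.

Lemma first_formE : first_form F p = metric_mx.
Proof.
apply/matrixP => a b; rewrite mxE euclidE !vpartial_soliton // herm_tangent /=.
rewrite /metric /metric_mx.
elim/ord_split_ind: a => [j|]; elim/ord_split_ind: b => [k|].
- rewrite block_mxEul [RHS]mxE !deltaE !mul0r addr0; congr (_ + _ * _).
  + under eq_bigr do rewrite !deltaE.
    by rewrite sum_delta eq_sym; case: eqVneq => [->|] //; rewrite !mulr0.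
  + by under eq_bigr do rewrite !deltaE; rewrite sum_delta.
  + by under eq_bigr do rewrite !deltaE; rewrite sum_delta.
- rewrite block_mxEur [RHS]mxE !deltaE.
  rewrite big1 => [|i _]; last by rewrite !deltaE mulr0.
  rewrite [X in _ * X]big1 => [|i _]; last by rewrite !deltaE mulr0.
  by ring.
- rewrite block_mxEdl [RHS]mxE !deltaE.
  rewrite big1 => [|i _]; last by rewrite !deltaE mulr0 mul0r.
  rewrite big1 => [|i _]; last by rewrite !deltaE mulr0.
  by ring.
- rewrite block_mxEdr [RHS]mxE !deltaE eqxx mulr1n.
  rewrite big1 => [|i _]; last by rewrite !deltaE mulr0.
  rewrite big1 => [|i _]; last by rewrite !deltaE mulr0.
  by ring.
Qed.

Lemma metric_inverse : metric_mx *m inverse_metric = 1%:M.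
Proof.
have Sn0 : S != 0 by rewrite gt_eqF // S_gt0.
have zn0 : sqmod (z s) * S != 0.
  by rewrite mulf_neq0 // gt_eqF // sqmod_gt0 // velocity_neq0.
rewrite mulmx_block !mulmx0 !mul0mx !addr0 !add0r -scalar_mxM mulfV //.
rewrite (_ : _ *m _ = 1%:M) -?scalar_mx_block //.
apply/matrixP => j l; rewrite !mxE.
pose c k := lambda k * x k.
transitivity (\sum_k (
   (d j s * (k == l)%:R / d k s - c l / d l s / S * (d j s * c k / d k s))
     * (k == j)%:R
   + c j / d l s * (c k * (k == l)%:R)
   - c j * (c l / d l s) / S * (c k ^+ 2 / d k s))).
  apply: eq_bigr => k _; rewrite !mxE -/(c j) -/(c k) -/(c l) [j == k]eq_sym.
  have := d_neq0 k; have := d_neq0 l.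
  by case: (eqVneq k l) => [->|_] /= dl dk; field; rewrite ?dl ?dk ?Sn0.
rewrite big_split sumrN big_split /= sum_delta -mulr_sumr sum_delta -mulr_sumr.
have -> : \sum_k c k ^+ 2 / d k s = S - 1 by rewrite /S addrC addKr.
have := d_neq0 j; have := d_neq0 l.
by case: (eqVneq j l) => [->|_] /= dl dj; field; rewrite ?dl ?dj ?Sn0.
Qed.

Lemma first_form_unit : first_form F p \in unitmx.
Proof. by rewrite first_formE; case/mulmx1_unit: metric_inverse. Qed.

Lemma invmx_first_form : invmx (first_form F p) = inverse_metric.
Proof.
rewrite -[LHS]mulmx1 -metric_inverse -first_formE mulKmx //; exact: first_form_unit.
Qed.

Lemma soliton_isotropic a b :
  complex.Im (herm (vpartial a F p) (vpartial b F p)) = 0.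
Proof. by rewrite !vpartial_soliton // herm_tangent. Qed.

(** Both summands of the trace in the $s$-direction contain the rank one
   correction $\sum_j\lambda_j v_j^2/|w_j|^4$ divided by $S$, with opposite signs. *)
Lemma trace_cubic c :
  \sum_a \sum_b inverse_metric a b * cubic (delta_mx 0 b) (delta_mx 0 a) (delta_mx 0 c)
  = - alpha * complex.Im (z s) * (c == rshift m 0)%:R.
Proof.
have cubic_xx j k :
    cubic (delta_mx 0 (lshift 1 k)) (delta_mx 0 (lshift 1 j)) (delta_mx 0 c)
    = complex.Im (z s) * lambda j * (c == rshift m 0)%:R * (k == j)%:R.
  rewrite /cubic !deltaE !mul0r addr0 (eq_bigr (fun i =>
    lambda i * (k == i)%:R * (c == rshift m 0)%:R * (i == j)%:R)).
    by rewrite sum_delta; ring.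
  move=> i _; rewrite !deltaE mxE eqxx [_ == c]eq_sym [i == k]eq_sym /=; ring.
have cubic_ss : cubic (delta_mx 0 (rshift m 0)) (delta_mx 0 (rshift m 0)) (delta_mx 0 c)
    = (c == rshift m 0)%:R * (sqmod (z s) * (complex.Im (velocity_rate s) * S
     + complex.Im (z s) * \sum_j lambda j * (lambda j * x j / d j s) ^+ 2)).
  rewrite /cubic !deltaE big1 => [|i _]; last by rewrite !deltaE; ring.
  by rewrite mulr0 add0r mxE eqxx [_ == c]eq_sym /=; ring.
rewrite big_split_ord big_ord1 /=.
rewrite big_split_ord big_ord1 /= [X in _ + (X + _)]big1 ?add0r => [|k _]; last first.
  by rewrite /inverse_metric block_mxEdl mxE mul0r.
rewrite cubic_ss /inverse_metric block_mxEdr mxE eqxx mulr1n.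
rewrite (eq_bigr (fun j => complex.Im (z s) * (c == rshift m 0)%:R * (lambda j / d j s)
   - complex.Im (z s) * (c == rshift m 0)%:R / S
     * (lambda j * (lambda j * x j / d j s) ^+ 2))); last first.
  move=> j _; rewrite big_split_ord big_ord1 /= block_mxEur mxE mul0r addr0.
  rewrite (eq_bigr (fun k => ((j == k)%:R / d j s
       - lambda j * x j / d j s * (lambda k * x k / d k s) / S)
       * (complex.Im (z s) * lambda j * (c == rshift m 0)%:R) * (k == j)%:R)).
    by rewrite sum_delta eqxx /=; ring.
  by move=> k _; rewrite block_mxEul mxE cubic_xx mulrA.
rewrite big_split sumrN /= -!mulr_sumr Im_velocity_rate.
have Sn0 : S != 0 by rewrite gt_eqF // S_gt0.
have zn0 : sqmod (z s) != 0 by rewrite gt_eqF // sqmod_gt0 // velocity_neq0.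
rewrite -/s.
set E := \sum_(i < m) _ * _ ^+ 2; set D := \sum_(i < m) _ / _.
by field; rewrite zn0 Sn0.
Qed.

Lemma soliton_mean_curvature :
  mean_curvature F p = normal_part F p (row_mx 0 (alpha%:C)%:M).
Proof.
apply: mean_curvature_eq_normal_part => [a b||c].
- exact: soliton_isotropic.
- exact: first_form_unit.
rewrite invmx_first_form vpartial_soliton //.
transitivity (- alpha * complex.Im (z s) * (c == rshift m 0)%:R).
  rewrite -trace_cubic; apply: eq_bigr => a _; apply: eq_bigr => b _.
  by rewrite vpartial2_soliton // Im_herm_hessian.
rewrite /tangent herm_row_mx big1 ?add0r => [|j _]; last by rewrite mxE mul0r.
rewrite -/s.
elim/ord_split_ind: c => [j|].
  rewrite !deltaE eq_lrshift mulr0.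
  by case: (z s) (\sum_j _) => [a b] t /=; ring.
rewrite !deltaE eqxx mulr1 big1 => [|j _]; last by rewrite !deltaE mulr0.
by case: (z s) => [a b] /=; ring.
Qed.

End AtPoint.

Lemma soliton_smooth k :
  multi_smooth_on U (fun p => complex.Re (F p 0 k)) /\
  multi_smooth_on U (fun p => complex.Im (F p 0 k)).
Proof.
have sq (j : 'I_m) : elementary I (rshift m 0)
    (fun p : 'rV[R]_(m + 1) => lambda j * (p 0 (lshift 1 j) * p 0 (lshift 1 j))).
  apply: elementaryM; first exact: elementary_cst.
  by apply: elementaryM; exact: elementary_coord.
split; apply: elementary_multi_smooth => //; elim/ord_split_ind: k => [j|].
- apply: elementary_eq (elementaryM (elementary_coord I (rshift m 0) (lshift 1 j))
     (elementary_lift (rshift m 0) (w_smooth j).1)) _ => p _.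
  by rewrite soliton_map_l; case: (w _ _) => a b /=; ring.
- apply: elementary_eq (elementaryD (elementaryM (elementary_cst I (rshift m 0) (- 2^-1))
    (elementary_sum sq)) (elementary_lift (rshift m 0) beta_smooth.1)) _ => p _.
  rewrite soliton_map_r mulNr; case: (beta _) => a b /=; congr (- (_ * _) + _).
- apply: elementary_eq (elementaryM (elementary_coord I (rshift m 0) (lshift 1 j))
     (elementary_lift (rshift m 0) (w_smooth j).2)) _ => p _.
  by rewrite soliton_map_l; case: (w _ _) => a b /=; ring.
- apply: elementary_eq (elementary_lift (rshift m 0) beta_smooth.2) _ => p _.
  by rewrite soliton_map_r; case: (beta _) => a b /=; ring.
Qed.

Lemma soliton_domainE : soliton_domain I = U.
Proof. by apply/funext => p; rewrite /soliton_domain /U /= mxE. Qed.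

Theorem soliton_lagrangian_translating :
  lagrangian_translating_soliton (@soliton_domain R m I) F
    [set soliton_point lambda w beta x s | x in setT & s in I]
    (row_mx 0 (alpha%:C)%:M).
Proof.
rewrite soliton_domainE; split.
- exact: slab_open.
- rewrite -soliton_domainE; apply/seteqP; split=> q.
    by move=> [p Ip <-]; exists (lsubmx p) => //; exists (rsubmx p 0 0).
  move=> [x _ [s Is <-]]; exists (row_mx x s%:M).
    by rewrite /soliton_domain /= row_mxKr mxE eqxx.
  by rewrite /F /soliton_map row_mxKl row_mxKr mxE eqxx.
- split; last first.
    by move=> p Up a b; rewrite symplecticE soliton_isotropic // oppr0.
  split=> [k|k|p Up c].
  + by have [] := soliton_smooth k.
  + by have [] := soliton_smooth k.
  + by apply: frame_free; [move=> a b; exact: soliton_isotropic|exact: first_form_unit].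
- exact: soliton_mean_curvature.
Qed.

End Immersion.

(** * Calculus on an interval *)

Section Calculus.
Variable R : realType.
Implicit Types (I : set R) (f F : R -> R).

Lemma zero_derive_cst I f (a b : R) : is_interval I -> I a -> I b ->
  (forall s, I s -> is_derive s 1 f 0) -> f a = f b.
Proof.
move=> I_itv; wlog ab : a b / a <= b.
  by move=> H Ia Ib f0; case: (leP a b) => [/H|/ltW /H ba]; [exact|apply/esym/ba].
move=> Ia Ib f0.
have Iab s : s \in `[a, b] -> I s by rewrite in_itv /=; exact: I_itv.
have [||c _] := @MVT_segment R f (cst 0) a b ab.
- by move=> s /subset_itv_oo_cc /Iab; exact: f0.
- by apply: derivable_within_continuous => s /Iab /f0 [].
by rewrite mul0r => /eqP; rewrite subr_eq0 => /eqP ->.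
Qed.

Lemma oriented_integral_FTC I f F (a b : R) : open I -> is_interval I -> I a -> I b ->
  (forall s, I s -> is_derive s 1 F (f s)) ->
  (forall s, I s -> derivable f s 1) ->
  oriented_integral a b f = F b - F a.
Proof.
move=> I_open I_itv Ia Ib dF df.
have ordered c e : I c -> I e -> c <= e ->
    \int[lebesgue_measure]_(t in `[c, e]) f t = F e - F c.
  move=> Ic Ie; rewrite le_eqVlt => /orP[/eqP ->|ce].
    by rewrite set_itv1 Rintegral_set1 subrr.
  have Ice s : s \in `[c, e] -> I s by rewrite in_itv /=; exact: I_itv.
  have cF s : I s -> {for s, continuous F}.
    move=> /dF [dFs _]; exact/differentiable_continuous/derivable1_diffP.
  rewrite /Rintegral (@continuous_FTC2 R f F c e ce) //.
  - by apply: derivable_within_continuous => s /Ice /df.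
  - split.
    + by move=> s /subset_itv_oo_cc /Ice /dF [].
    + by apply: cvg_at_right_filter; exact: cF.
    + by apply: cvg_at_left_filter; exact: cF.
  - by move=> s /subset_itv_oo_cc /Ice /dF [_ <-]; rewrite derive1E.
rewrite /oriented_integral; case: leP => [|/ltW] ?; rewrite ordered //.
by rewrite opprB.
Qed.

Lemma expiD (a b : R) : expi (a + b) = expi a * expi b.
Proof.
by apply/eqP; rewrite eq_complex /expi /= cosD sinD; apply/andP; split; apply/eqP; ring.
Qed.

Lemma prod_expi (m : nat) (a : 'I_m -> R) :
  \prod_k expi (a k) = expi (\sum_k a k).
Proof.
elim: (index_enum _) => [|k s ih]; first by rewrite !big_nil /expi cos0 sin0.
by rewrite !big_cons ih expiD.
Qed.

Lemma is_derive_ln_prod (m : nat) (a l : 'I_m -> R) (v : R) :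
  (forall j, 0 < a j + l j * v) ->
  is_derive v 1 (fun y => ln (\prod_j (a j + l j * y))) (\sum_j l j / (a j + l j * v)).
Proof.
move=> pos.
have Qpos : 0 < \prod_j (a j + l j * v) by apply: prodr_gt0 => j _.
have daff j : is_derive v 1 (fun y => a j + l j * y)
    (l j / (a j + l j * v) * (a j + l j * v)).
  apply: is_derive_congr (is_deriveD (is_derive_cst (a j) v 1)
    (is_deriveM (is_derive_cst (l j) v 1) (is_derive_id v 1))) _ _ => [y|].
    by rewrite !fctE.
  by rewrite /GRing.scale /= divfK ?gt_eqF //; ring.
have dprod : is_cderive_along v 1 (fun y => \prod_j (a j + l j * y)%:C)
  ((\sum_j (l j / (a j + l j * v))%:C) * \prod_j (a j + l j * v)%:C).
  apply: (is_cderive_along_prod predT) => j; rewrite -rmorphM.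
  exact: is_cderive_along_real.
have dQ : is_derive v 1 (fun y => \prod_j (a j + l j * y))
    ((\sum_j l j / (a j + l j * v)) * \prod_j (a j + l j * v)).
  apply: is_derive_congr dprod.1 _ _ => [y|].
    by rewrite -rmorph_prod.
  by rewrite -rmorph_prod -rmorph_sum -rmorphM.
apply: is_derive_congr (is_derive1_comp (is_derive1_ln Qpos) dQ) _ _ => //.
by rewrite mulrCA mulVf ?mulr1 // gt_eqF.
Qed.

End Calculus.

(** * Polar coordinates *)

Section Polar.
Variables (R : realType) (m : nat) (I : set R).
Variables (lambda : 'I_m -> R) (alpha : R) (theta : R -> R).
Variables (w : 'I_m -> R -> R[i]) (beta : R -> R[i]).
Hypothesis alpha_neq0 : alpha != 0.
Hypothesis I_open : open I.
Hypothesis I_itv : is_interval I.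
Hypothesis w_neq0 : forall j s, I s -> w j s != 0.
Hypothesis w_ode : forall j s, I s -> is_cderive s (w j)
  ((lambda j)%:C * expi (theta s) * (\prod_(k < m | k != j) w k s)^*%C).
Hypothesis theta_ode : forall s, I s -> is_derive s 1 theta
  (alpha * complex.Im (expi (- theta s) * \prod_(k < m) w k s)).
Hypothesis beta_ode : forall s, I s ->
  is_cderive s beta (expi (theta s) * (\prod_(k < m) w k s)^*%C).
Variables r phi_ : 'I_m -> R -> R.
Hypothesis r_smooth : forall j, smooth_on I (r j).
Hypothesis r_gt0 : forall j s, I s -> 0 < r j s.
Hypothesis phi_smooth : forall j, smooth_on I (phi_ j).
Hypothesis w_polar : forall j s, I s -> w j s = (r j s)%:C * expi (phi_ j s).
Variable s0 : R.
Hypothesis s0_in : I s0.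

Let phi (s : R) := \sum_(j < m) phi_ j s.
Let alpha_ j := r j s0 ^+ 2.
Let u (s : R) := 2 * oriented_integral s0 s
  (fun t => (\prod_(j < m) r j t) * cos (phi t - theta t)).
Let Q (v : R) := \prod_(j < m) (alpha_ j + lambda j * v).
Local Notation z := (velocity theta w).

Lemma velocity_polar s : I s -> z s = (\prod_j r j s)%:C * expi (theta s - phi s).
Proof.
move=> Is; rewrite /velocity (eq_bigr _ (fun j _ => w_polar j Is)) big_split /=.
rewrite -rmorph_prod prod_expi -/(phi s) expiD /expi cosN sinN.
by apply/eqP; rewrite eq_complex /=; apply/andP; split; apply/eqP; ring.
Qed.

Lemma Re_velocity s : I s ->
  complex.Re (z s) = (\prod_j r j s) * cos (phi s - theta s).
Proof. by move=> Is; rewrite velocity_polar // -[phi s - _]opprB cosN /=; ring. Qed.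

Lemma Im_velocity s : I s ->
  complex.Im (z s) = - ((\prod_j r j s) * sin (phi s - theta s)).
Proof. by move=> Is; rewrite velocity_polar // -[phi s - _]opprB sinN /=; ring. Qed.

Lemma near_I s : I s -> \forall t \near s, I t.
Proof. by move=> Is; apply: open_nbhs_nbhs. Qed.

(** On [I] the integrand of [u] is the derivative of the real part of [beta]. *)
Lemma u_beta s : I s -> u s = 2 * (complex.Re (beta s) - complex.Re (beta s0)).
Proof.
move=> Is; congr (_ * _).
apply: (oriented_integral_FTC
  (F := fun s => complex.Re (beta s)) I_open I_itv) => // t It.
  by rewrite -Re_velocity //; exact: (beta_ode It).1.
have [[dz _] _] := velocity_derive w_neq0 w_ode theta_ode It.
apply: near_eq_derivable dz.
by apply: filterS (near_I It) => y Iy; exact: Re_velocity.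
Qed.

Lemma u_derive s : I s -> is_derive s 1 u (2 * complex.Re (z s)).
Proof.
move=> Is.
have db := (beta_ode Is).1.
have d2 := is_derive_cst (2 : R) s (1 : R).
have dc := is_derive_cst (complex.Re (beta s0)) s (1 : R).
apply: (@near_eq_is_derive _ _ _
  (fun s => 2 * (complex.Re (beta s) - complex.Re (beta s0)))).
  by apply: filterS (near_I Is) => t It; rewrite u_beta.
apply: is_derive_congr (is_deriveM d2 (is_deriveB db dc)) _ _ => [t|].
  by rewrite !fctE.
by rewrite /GRing.scale /= /velocity; ring.
Qed.

Lemma sqmod_w j s : I s -> sqmod (w j s) = r j s ^+ 2.
Proof.
move=> Is; rewrite w_polar // /sqmod /=.
rewrite -[RHS]mulr1 -(cos2Dsin2 (phi_ j s)); ring.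
Qed.

Lemma log_rateE j s : I s ->
  log_rate lambda theta w j s = (lambda j / r j s ^+ 2)%:C * z s.
Proof. by move=> Is; rewrite /log_rate sqmod_w. Qed.

Lemma r_neq0 j s : I s -> r j s != 0.
Proof. by move=> Is; rewrite gt_eqF // r_gt0. Qed.

(** $(|w_j|^2)' = 2\,\mathrm{Re}(w_j'\,\overline{w_j})
   = 2\lambda_j\,\mathrm{Re}\,z = \lambda_j u'$. *)
Lemma r2_linear j s : I s -> r j s ^+ 2 = alpha_ j + lambda j * u s.
Proof.
move=> Is.
have cst_s : forall t, I t -> is_derive t 1
    (fun t => sqmod (w j t) - 2 * lambda j * complex.Re (beta t)) 0.
  move=> t It; have dw := w_ode_log w_neq0 w_ode j It.
  have [dww _] := is_cderive_alongM dw (is_cderive_along_conj dw).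
  have dl := is_derive_cst (2 * lambda j) t (1 : R).
  apply: is_derive_congr (is_deriveB dww (is_deriveM dl (beta_ode It).1)) _ _ => [y|].
    by rewrite !fctE mul_conjc.
  rewrite -/(velocity theta w t) /GRing.scale /= log_rateE // -sqmod_w //.
  have : sqmod (w j t) != 0 by rewrite gt_eqF // sqmod_gt0 // w_neq0.
  rewrite /sqmod; case: (w j t) (z t) => [a b] [e f] /= n0.
  by field.
have := zero_derive_cst I_itv Is s0_in cst_s.
rewrite !sqmod_w // /alpha_ u_beta // => E; lra.
Qed.

Lemma sqrtQ s : I s -> Num.sqrt (Q (u s)) = \prod_j r j s.
Proof.
move=> Is; rewrite /Q -(eq_bigr _ (fun j _ => r2_linear j Is)) prodrXl.
rewrite sqrtr_sqr ger0_norm //.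
by apply: prodr_ge0 => j _; rewrite ltW // r_gt0.
Qed.

(** The imaginary part of $w_j'/w_j = r_j'/r_j + i\phi_j'$. *)
Lemma phi_derive j s : I s -> is_derive s 1 (phi_ j)
  (lambda j / r j s ^+ 2 * complex.Im (z s)).
Proof.
move=> Is.
have dr : is_derive s 1 (r j) ('D_1 (r j) s).
  by apply: derivableP; exact: (r_smooth (k := 0%N) Is).
have dphi : is_derive s 1 (phi_ j) ('D_1 (phi_ j) s).
  by apply: derivableP; exact: (phi_smooth (k := 0%N) Is).
suff <- : 'D_1 (phi_ j) s = lambda j / r j s ^+ 2 * complex.Im (z s) by [].
have dw : is_cderive s (w j) (((r j s)^-1 * 'D_1 (r j) s +i* 'D_1 (phi_ j) s) * w j s).
  apply: (@near_eq_is_cderive_along _ _ _ _ (fun t => (r j t)%:C * expi (phi_ j t))).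
    by apply: filterS (near_I Is) => t It; rewrite w_polar.
  apply: is_cderive_along_congr (is_cderive_alongM
    (is_cderive_along_real dr) (is_cderive_expi dphi)) _ _ => //.
  rewrite w_polar //; have := r_neq0 j Is.
  case: (expi _) => a b n0; apply/eqP; rewrite eq_complex /=.
  by apply/andP; split; apply/eqP; field.
have := is_cderive_along_unique dw (w_ode_log w_neq0 w_ode j Is).
move/(mulIf (w_neq0 j Is)); rewrite log_rateE //; case: (z s) => e f [_ ->] /=.
by ring.
Qed.

(** The real part is the definition of $u$; in the imaginary part
   $\mathrm{Im}\,\beta' = \mathrm{Im}\,z = -\theta'/\alpha$. *)
Lemma beta_polar : exists K, forall s, I s ->
  beta s = (2^-1 * u s)%:C - 'i * (theta s / alpha)%:C + K.
Proof.
exists (beta s0 + 'i * (theta s0 / alpha)%:C) => s Is.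
have cst_s : forall t, I t -> is_derive t 1
    (fun t => complex.Im (beta t) + theta t / alpha) 0.
  move=> t It.
  have da := is_derive_cst (alpha^-1) t (1 : R).
  apply: is_derive_congr (is_deriveD (beta_ode It).2
    (is_deriveM (theta_ode_velocity theta_ode It) da)) _ _ => [y|].
    by rewrite !fctE.
  by rewrite -/(velocity theta w t) /GRing.scale /=; field.
have := zero_derive_cst I_itv Is s0_in cst_s.
rewrite u_beta //; case: (beta s) (beta s0) => [a b] [c e] /= E.
apply/eqP; rewrite eq_complex /=; apply/andP; split; apply/eqP.
  by field.
lra.
Qed.

(** $\mathrm{Im}\,z' = \mathrm{Im}(\mu z) = \theta'\,\mathrm{Re}\,z$, because
   $\overline{\sum_j l_j}\,z$ is real, and $\theta' = -\alpha\,\mathrm{Im}\,z$. *)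
Lemma first_integral : exists A : R, forall s, I s ->
  Num.sqrt (Q (u s)) * expR (alpha * u s / 2) * sin (phi s - theta s) = A.
Proof.
pose f s := complex.Im (z s) * expR (alpha * complex.Re (beta s)).
have df s : I s -> is_derive s 1 f 0.
  move=> Is.
  have [_ dz] := velocity_derive w_neq0 w_ode theta_ode Is.
  have da := is_derive_cst alpha s (1 : R).
  have de := is_derive1_comp (is_derive_expR _) (is_deriveM da (beta_ode Is).1).
  apply: is_derive_congr (is_deriveM dz de) _ _ => [t|].
    by rewrite !fctE.
  rewrite -/(velocity theta w s) /GRing.scale /= !fctE.
  have -> : complex.Im (z s * velocity_rate lambda alpha theta w s)
      = - alpha * complex.Im (z s) * complex.Re (z s).
    have Lr : \sum_k log_rate lambda theta w k s
        = (\sum_k lambda k / sqmod (w k s))%:C * z s.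
      by rewrite rmorph_sum mulr_suml.
    by rewrite /velocity_rate Lr; case: (z s) => a b /=; ring.
  by ring.
exists (- f s0 * expR (- alpha * complex.Re (beta s0))) => s Is.
rewrite -(zero_derive_cst I_itv Is s0_in df) sqrtQ // /f Im_velocity //.
rewrite u_beta // (_ : alpha * _ / 2
  = alpha * complex.Re (beta s) + - alpha * complex.Re (beta s0)).
  by rewrite expRD; ring.
by field.
Qed.

End Polar.

Theorem corollaryH (R : realType) (n : nat) (n_ge2 : (2 <= n)%N)
  (lambda : 'I_n.-1 -> R) (lambda_neq0 : forall j, lambda j != 0)
  (alpha : R) (alpha_neq0 : alpha != 0)
  (I : set R) (I_open : open I) (I_itv : is_interval I)
  (theta : R -> R) (w : 'I_n.-1 -> R -> R[i]) (beta : R -> R[i])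
  (theta_smooth : smooth_on I theta)
  (w_smooth : forall j, csmooth_on I (w j))
  (w_neq0 : forall j s, I s -> w j s != 0)
  (beta_smooth : csmooth_on I beta)
  (w_ode : forall j s, I s ->
     is_cderive s (w j)
       ((lambda j)%:C * expi (theta s) * (\prod_(k < n.-1 | k != j) w k s)^*%C))
  (theta_ode : forall s, I s ->
     is_derive s 1 theta
       (alpha * complex.Im (expi (- theta s) * \prod_(k < n.-1) w k s)))
  (beta_ode : forall s, I s ->
     is_cderive s beta (expi (theta s) * (\prod_(k < n.-1) w k s)^*%C))
  (r phi_ : 'I_n.-1 -> R -> R)
  (r_smooth : forall j, smooth_on I (r j))
  (r_gt0 : forall j s, I s -> 0 < r j s)
  (phi_smooth : forall j, smooth_on I (phi_ j))
  (w_polar : forall j s, I s -> w j s = (r j s)%:C * expi (phi_ j s))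
  (s0 : R) (s0_in : I s0) :
  let L := [set soliton_point lambda w beta x s | x in setT & s in I] in
  let phi := fun s : R => \sum_(j < n.-1) phi_ j s in
  let alpha_ := fun j : 'I_n.-1 => r j s0 ^+ 2 in
  let u := fun s : R =>
    2 * oriented_integral s0 s
          (fun t => (\prod_(j < n.-1) r j t) * cos (phi t - theta t)) in
  let Q := fun v : R => \prod_(j < n.-1) (alpha_ j + lambda j * v) in
  lagrangian_translating_soliton
    (@soliton_domain R n.-1 I) (soliton_map lambda w beta) L
    (row_mx 0 (alpha%:C)%:M)
  /\ (exists K : R[i],
        L = [set (row_mx
                    (\row_(j < n.-1) ((x 0 j)%:C
                       * (Num.sqrt (alpha_ j + lambda j * u s))%:C
                       * expi (phi_ j s)))
                    ((2^-1 * u s)%:C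
                     - (2^-1 * \sum_(j < n.-1) lambda j * x 0 j ^+ 2)%:C
                     - 'i%C * (theta s / alpha)%:C + K)%:M
                  : 'rV[R[i]]_(n.-1 + 1))
             | x in [set: 'rV[R]_n.-1] & s in I])
  /\ (forall j s, I s -> 0 < alpha_ j + lambda j * u s)
  /\ (forall s, I s ->
        is_derive s 1 u (2 * Num.sqrt (Q (u s)) * cos (phi s - theta s)))
  /\ (forall j s, I s ->
        is_derive s 1 (phi_ j)
          (- (lambda j * Num.sqrt (Q (u s)) * sin (phi s - theta s)
              / (alpha_ j + lambda j * u s))))
  /\ (forall s, I s ->
        is_derive s 1 phi
          (- (Num.sqrt (Q (u s)) * derive1 (fun v => ln (Q v)) (u s)
              * sin (phi s - theta s))))
  /\ (forall s, I s ->
        is_derive s 1 theta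
          (alpha * Num.sqrt (Q (u s)) * sin (phi s - theta s)))
  /\ (exists A : R, forall s, I s ->
        Num.sqrt (Q (u s)) * expR (alpha * u s / 2) * sin (phi s - theta s) = A).
Proof.
move=> L phi alpha_ u Q.
have rE j s : I s -> r j s ^+ 2 = alpha_ j + lambda j * u s
  by move=> Is; exact: (r2_linear I_open I_itv w_neq0 w_ode theta_ode beta_ode
    w_polar s0_in j Is).
have sqrtQE s : I s -> Num.sqrt (Q (u s)) = \prod_(j < n.-1) r j s
  by move=> Is; exact: (sqrtQ I_open I_itv w_neq0 w_ode theta_ode beta_ode
    r_gt0 w_polar s0_in Is).
have ImE s : I s -> complex.Im (velocity theta w s)
    = - (Num.sqrt (Q (u s)) * sin (phi s - theta s)).
  by move=> Is; rewrite sqrtQE //; exact: (Im_velocity theta w_polar Is).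
have aff_gt0 j s : I s -> 0 < alpha_ j + lambda j * u s
  by move=> Is; rewrite -rE // exprn_gt0 // r_gt0.
have phiD j s : I s -> is_derive s 1 (phi_ j)
    (- (lambda j * Num.sqrt (Q (u s)) * sin (phi s - theta s)
        / (alpha_ j + lambda j * u s))).
  move=> Is; apply: is_derive_congr (phi_derive I_open w_neq0 w_ode
    r_smooth r_gt0 phi_smooth w_polar j Is) _ _ => //.
  by rewrite ImE // rE //; ring.
split; first exact: (soliton_lagrangian_translating I_open w_smooth w_neq0
    beta_smooth w_ode theta_ode beta_ode).
split.
  have [K betaE] : exists K, forall s, I s ->
      beta s = (2^-1 * u s)%:C - 'i%C * (theta s / alpha)%:C + K.
    exact: (beta_polar alpha_neq0 I_open I_itv w_neq0 w_ode theta_ode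
      beta_ode w_polar s0_in).
  exists K.
  have pointE x s : I s -> soliton_point lambda w beta x s
    = row_mx (\row_(j < n.-1) ((x 0 j)%:C
                       * (Num.sqrt (alpha_ j + lambda j * u s))%:C
                       * expi (phi_ j s)))
             ((2^-1 * u s)%:C
                     - (2^-1 * \sum_(j < n.-1) lambda j * x 0 j ^+ 2)%:C
                     - 'i%C * (theta s / alpha)%:C + K)%:M.
    move=> Is; rewrite /soliton_point; congr (row_mx _ _%:M).
      apply/rowP => j; rewrite !mxE w_polar // mulrA -rE // sqrtr_sqr.
      by rewrite ger0_norm // ltW // r_gt0.
    by rewrite betaE //; ring.
  by apply/seteqP; split=> q [x _ [s Is <-]]; exists x => //; exists s; rewrite ?pointE.
split=> //; split.
  move=> s Is; apply: is_derive_congr (u_derive I_open I_itv w_neq0 w_ode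
    theta_ode beta_ode w_polar s0_in Is) _ _ => //.
  by rewrite sqrtQE // -mulrA; congr (_ * _); exact: (Re_velocity theta w_polar Is).
split=> //; split.
  move=> s Is.
  have dsum := is_derive_sum (fun j => phiD j s Is).
  have [_] := is_derive_ln_prod (fun j => aff_gt0 j s Is).
  rewrite -derive1E => lnE.
  apply: is_derive_congr dsum _ _ => [t|].
    by rewrite fct_sumE.
  rewrite lnE mulr_sumr mulr_suml -sumrN; apply: eq_bigr => j _; ring.
split.
  move=> s Is; apply: is_derive_congr (theta_ode_velocity theta_ode Is) _ _ => //.
  by rewrite ImE //; ring.
exact: (first_integral I_open I_itv w_neq0 w_ode theta_ode beta_ode r_gt0 w_polar s0_in).
Qed.
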